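(* Let $0<p\le\infty$, $\alpha>0$ and $\beta\in\mathbb{R}$ satisfy $\alpha+1/p-1/2>0$ (with $1/p:=0$ when $p=\infty$), and let $\mathbf{w}=(w_j)_{j\in\mathbb{N}}$ with $$w_j:=\max_{1\le i\le j}\,i^{\alpha}[\log(i+1)]^{\beta},\qquad j\in\mathbb{N}.$$ Then $$\sigma_n\big(U(\ell_p(\mathbf{w}))\big)\asymp n^{-(\alpha+1/p-1/2)}[\log(n+1)]^{-\beta},$$ that is, there are constants $C_1,C_2>0$, independent of $n$ (but possibly depending on $p,\alpha,\beta$), such that for all integers $n\ge1$, $$C_1\,n^{-(\alpha+1/p-1/2)}[\log(n+1)]^{-\beta}\le\sigma_n\big(U(\ell_p(\mathbf{w}))\big)\le C_2\,n^{-(\alpha+1/p-1/2)}[\log(n+1)]^{-\beta}.$$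
   Context: Let $\ell_2$ be the Hilbert space of real sequences $\mathbf{x}=(x_1,x_2,\ldots)$ with $\|\mathbf{x}\|_{\ell_2}^2=\sum_{j}|x_j|^2<\infty$, and let $(e_j)_{j\in\mathbb{N}}$ be its canonical basis. For $n\ge1$ let $\Sigma_n:=\{\sum_{j\in\Lambda}c_je_j:\ \Lambda\subset\mathbb{N},\ |\Lambda|=n,\ c_j\in\mathbb{R}\}$. For $\mathbf{x}\in\ell_2$ define the error of $n$-term approximation $\sigma_n(\mathbf{x}):=\inf_{S\in\Sigma_n}\|\mathbf{x}-S\|_{\ell_2}$, and for $K\subset\ell_2$ define $\sigma_n(K):=\sup_{\mathbf{x}\in K}\sigma_n(\mathbf{x})$. For $0<p\le\infty$ and a nondecreasing sequence of positive weights $\mathbf{w}=(w_j)_{j\in\mathbb{N}}$, the space $\ell_p(\mathbf{w})$ is the set of all real sequences $\mathbf{x}\in\ell_2$ with $\|\mathbf{x}\|_{\ell_p(\mathbf{w})}<\infty$, where $\|\mathbf{x}\|_{\ell_p(\mathbf{w})}:=\left[\sum_{j=1}^\infty|w_jx_j|^p\right]^{1/p}$ for $0<p<\infty$ and $\|\mathbf{x}\|_{\ell_\infty(\mathbf{w})}:=\sup_j|w_jx_j|$ for $p=\infty$. Its unit ball is $U(\ell_p(\mathbf{w})):=\{\mathbf{x}\in\ell_p(\mathbf{w}):\|\mathbf{x}\|_{\ell_p(\mathbf{w})}\le1\}$. *)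

(* Defs.v *)
From HB Require Import structures.
From mathcomp Require Import all_boot all_order all_algebra finmap.
From mathcomp Require Import all_classical all_reals all_analysis.

Set Implicit Arguments.
Unset Strict Implicit.
Unset Printing Implicit Defensive.

Import Order.TTheory GRing.Theory Num.Theory.
Import numFieldNormedType.Exports.

Local Open Scope classical_set_scope.
Local Open Scope ring_scope.

(* Sequences (x_1, x_2, ...) are represented as functions on nat with the
   index shifted by one: x j : R stands for x_(j+1). *)

Definition lp_norm (R : realType) (p : \bar R) (x : R^nat) : \bar R :=
  'N[@counting nat R]_p[EFin \o x].

Lemma lp_norm_fin (R : realType) (p : R) (x : R^nat) : 0 < p ->
  lp_norm p%:E x =
    ((\sum_(0 <= j <oo) (`|x j| `^ p)%:E) `^ p^-1)%E.
Proof. by move=> p0; rewrite /lp_norm Lnorm_counting. Qed.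

Lemma lp_norm_infty (R : realType) (x : R^nat) :
  lp_norm +oo%E x = ereal_sup (range (fun j => (`|x j|)%:E)).
Proof.
rewrite /lp_norm unlock /=.
have cpos (A : set nat) j : A j -> (0 < @counting nat R A)%E.
  move=> Aj; rewrite /counting; case: asboolP => [fA|_]; last by rewrite ltry.
  rewrite lte_fin ltr0n cardfs_gt0; apply/fset0Pn; exists j.
  by rewrite in_fset_set// inE.
rewrite (cpos setT 0%N I); apply/eqP; rewrite eq_le; apply/andP; split.
  apply: ereal_inf_lbound => /=; apply/aeW => j /=.
  by apply: ereal_sup_ubound; exists j.
apply: le_ereal_inf_tmp => y /= [A [mA A0 sA]].
apply: ge_ereal_sup => _ [j _ <-].
case: (pselect (`|x j|%:E <= y)%E) => // nle.
by have := cpos A j (sA _ nle); rewrite A0 ltxx.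
Qed.

Definition l2_norm (R : realType) (x : R^nat) : \bar R := lp_norm 2%:E x.

Definition l2 (R : realType) : set (R^nat) := [set x | l2_norm x < +oo]%E.

Definition lpw_norm (R : realType) (p : \bar R) (w x : R^nat) : \bar R :=
  lp_norm p (fun j => w j * x j).

Definition lpw (R : realType) (p : \bar R) (w : R^nat) : set (R^nat) :=
  [set x | l2 x /\ (lpw_norm p w x < +oo)%E].

Definition lpw_ball (R : realType) (p : \bar R) (w : R^nat) : set (R^nat) :=
  [set x | lpw p w x /\ (lpw_norm p w x <= 1)%E].

Definition basis_vec (R : realType) (j : nat) : R^nat := fun k => (k == j)%:R.

Definition n_term (R : realType) (n : nat) : set (R^nat) :=
  [set S | exists (L : {fset nat}) (c : R^nat),
     #|` L| = n /\ S = \sum_(j <- L) c j *: basis_vec R j].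

Definition sigma (R : realType) (n : nat) (x : R^nat) : \bar R :=
  ereal_inf [set l2_norm (x - S) | S in n_term n].

Definition sigma_set (R : realType) (n : nat) (K : set (R^nat)) : \bar R :=
  ereal_sup [set sigma n x | x in K].

(* All terms of the maximum are positive, so its default value 0 is harmless;
   with the index shift, weight alpha beta j is w_(j+1). *)
Definition weight (R : realType) (alpha beta : R) : R^nat := fun j =>
  \big[Num.max/0]_(1 <= i < j.+2) (i%:R `^ alpha * ln i.+1%:R `^ beta).

(* Main.v *)
Require Import Defs.
From mathcomp Require Import all_boot all_order all_algebra finmap ring lra zify.
From mathcomp Require Import all_classical all_reals all_analysis.

(** Write $r = 1/p$, $s = \alpha + r - 1/2$ and
    $\varphi(j) = j^\alpha \log(j+1)^\beta$; the claimed rate is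
    $n^{-s}\log(n+1)^{-\beta} = n^{1/2-r}/\varphi(n)$.

    A positive power of $j$ absorbs every power of the logarithm, so $\varphi$
    is increasing up to a constant ([plog_almost_incr]). Hence the running
    maximum $w_j$ is comparable with $\varphi(j)$ ([weight_equiv]), and
    $\varphi(n)$ and $\varphi(2n)$ are comparable ([plog_doubling]).

    Lower bound ([sigma_ge_flat]): the vector with its first $2n$ entries equal
    to a constant of order $(2n)^{-r}/\varphi(2n)$ lies in the ball, and any $n$
    terms miss at least $n$ of these entries.

    Upper bound, $p \le 2$ ([sigma_le_sparse]): with $h = \lceil n/2\rceil$, keep
    the first $h$ entries and those with $w_j|x_j| > h^{-1/p}$; the latter are
    fewer than $h$ by Chebyshev. On the remaining entries
    $|x_j|^2 \lesssim \varphi(h)^{-2}\, h^{-(2-p)/p}\, |w_jx_j|^p$, which sums to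
    $\lesssim (h^{1/2-1/p}/\varphi(h))^2$.

    Upper bound, $p > 2$ or $p = \infty$ ([sigma_le_tail]): the first $n$ entries
    suffice. Hölder's inequality is replaced by the pointwise bound
    $(w_jx_j)^2 \le |w_jx_j|^p j^{1-2/p} + j^{-2/p}$, which for $p = \infty$ reads
    $(w_jx_j)^2 \le 1$. Division by $w_j^2 \gtrsim \varphi(n)^2 (j/n)^{2\alpha - s}$
    gives the first term the factor $j^{-s}$, bounded on the tail, and turns the
    second into the summable $j^{-1-s}$. *)

Set Implicit Arguments.
Unset Strict Implicit.
Unset Printing Implicit Defensive.

Import Order.TTheory GRing.Theory Num.Theory.
Import numFieldNormedType.Exports.
Local Open Scope classical_set_scope.
Local Open Scope ring_scope.

(** * Powers with a logarithmic factor *)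

Definition plog (R : realType) (a b : R) (n : nat) : R :=
  n%:R `^ a * ln n.+1%:R `^ b.

Section PowerLog.
Variable R : realType.
Implicit Types (a b c d : R) (i j n : nat).

Lemma lnS_gt0 n : (0 < n)%N -> 0 < ln n.+1%:R :> R.
Proof. by move=> n0; apply: ln_gt0; rewrite ltr1n. Qed.

Lemma lnS_le i j : (i <= j)%N -> ln i.+1%:R <= ln j.+1%:R :> R.
Proof. by move=> ij; rewrite ler_ln ?posrE ?ltr0n// ler_nat. Qed.

Lemma powRDp (x a b : R) : 0 < x -> x `^ (a + b) = x `^ a * x `^ b.
Proof. by move=> x0; rewrite powRD ?(gt_eqF x0) ?implybT. Qed.

Lemma plog_gt0 a b n : (0 < n)%N -> 0 < plog a b n.
Proof.
by move=> n0; rewrite /plog mulr_gt0 ?powR_gt0 ?ltr0n ?lnS_gt0.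
Qed.

Lemma plogD a b c d n : (0 < n)%N ->
  plog (a + c) (b + d) n = plog a b n * plog c d n.
Proof.
by move=> n0; rewrite /plog !powRDp ?lnS_gt0 ?ltr0n// mulrACA.
Qed.

Lemma plogN a b n : plog (- a) (- b) n = (plog a b n)^-1.
Proof. by rewrite /plog !powRN invfM. Qed.

Lemma plog0 a n : plog a 0 n = n%:R `^ a.
Proof. by rewrite /plog powRr0 mulr1. Qed.

Lemma plogB (a b c : R) n : (0 < n)%N ->
  plog (c - a) (- b) n = n%:R `^ c / plog a b n.
Proof. by move=> n0; rewrite -plogN -(plog0 c) -plogD// add0r. Qed.

Lemma powR_half_sqr (x a : R) : (x `^ (a / 2)) ^+ 2 = x `^ a.
Proof. by rewrite -powR_mulrn ?powR_ge0// -powRrM divfK. Qed.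

(** Since $(j+1)/(i+1) \le j/i =: u$, the logarithm grows from $i$ to $j$ by at
    most $\log u \le (u^a - 1)/a$. *)
Lemma lnS_slow a : 0 < a -> exists2 C, 0 < C & forall i j, (0 < i <= j)%N ->
  ln j.+1%:R * i%:R `^ a <= C * (j%:R `^ a * ln i.+1%:R).
Proof.
move=> a0; have l2 : 0 < ln 2 :> R by exact: (@lnS_gt0 1).
exists (1 + (a * ln 2)^-1); first by rewrite addr_gt0// invr_gt0 mulr_gt0.
move=> i j /andP[i0 ij]; have j0 : (0 < j)%N by apply: leq_trans ij.
have iR : 0 < i%:R :> R by rewrite ltr0n.
have jR : 0 < j%:R :> R by rewrite ltr0n.
have ijR : i%:R <= j%:R :> R by rewrite ler_nat.
have li := @lnS_gt0 i i0.
have l2i : ln 2 <= ln i.+1%:R :> R by exact: lnS_le.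
pose q : R := j%:R / i%:R; pose u := q `^ a.
have q1 : 1 <= q by rewrite ler_pdivlMr// mul1r.
have q0 : 0 < q by apply: lt_le_trans q1.
have u1 : 1 <= u by rewrite -[leLHS](powRr0 q) ler_powR// ltW.
have uE : j%:R `^ a = u * i%:R `^ a.
  by rewrite /u -powRM ?ltW// /q divfK// gt_eqF.
have jl : ln j.+1%:R <= ln i.+1%:R + ln q :> R.
  rewrite -lnM ?posrE ?ltr0n// ler_ln ?posrE ?mulr_gt0 ?ltr0n ?invr_gt0//.
  by rewrite /q mulrA ler_pdivlMr// -!natrM ler_nat; nia.
have aq : a * ln q <= u - 1.
  rewrite -ln_powR -/u; have := @le_ln1Dx R (u - 1).
  by rewrite [1 + _]addrC subrK; apply; lra.
have lq : ln q <= (a * ln 2)^-1 * (u * ln i.+1%:R).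
  rewrite mulrC ler_pdivlMr ?mulr_gt0//.
  have : a * ln q * ln 2 <= u * ln 2.
    by rewrite ler_wpM2r ?ltW//; lra.
  have : u * ln 2 <= u * ln i.+1%:R by rewrite ler_wpM2l//; lra.
  by lra.
rewrite uE mulrAC mulrA ler_wpM2r ?powR_ge0//.
rewrite mulrDl mul1r; apply: le_trans jl _.
by rewrite lerD// -[leLHS]mul1r ler_wpM2r// ltW.
Qed.

(** Only $b < 0$ needs an argument: it is [lnS_slow] with exponent $a/(-b)$,
    raised to the power $-b$. *)
Lemma plog_almost_incr a b : 0 < a -> exists2 C, 0 < C &
  forall i j, (0 < i <= j)%N -> plog a b i <= C * plog a b j.
Proof.
move=> a0; have [b0|b0] := leP 0 b.
  exists 1 => // i j /andP[i0 ij]; rewrite mul1r /plog.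
  by rewrite ler_pM ?powR_ge0// ge0_ler_powR ?nnegrE ?ler0n ?ler_nat ?lnS_le//;
    rewrite ltW// ?lnS_gt0// (leq_trans i0).
have c0 : 0 < - b by rewrite oppr_gt0.
have [K K0 HK] := @lnS_slow (a / - b) (divr_gt0 a0 c0).
exists (K `^ (- b)) => [|i j /andP[i0 ij]]; first exact: powR_gt0.
have j0 : (0 < j)%N by apply: leq_trans ij.
have li := @lnS_gt0 i i0; have lj := @lnS_gt0 j j0.
have := HK i j; rewrite i0 ij => /(_ isT) H.
have {H} : (ln j.+1%:R * i%:R `^ (a / - b)) `^ (- b) <=
       (K * (j%:R `^ (a / - b) * ln i.+1%:R)) `^ (- b).
  by rewrite ge0_ler_powR ?nnegrE ?(mulr_ge0, powR_ge0)// ltW.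
rewrite !powRM ?(mulr_ge0, powR_ge0) ?(ltW K0) ?(ltW li) ?(ltW lj)//.
rewrite -!powRrM !divfK ?gt_eqF// /plog => H.
have E x : 0 < x -> x `^ b = (x `^ - b)^-1 by move=> x0; rewrite -powRN opprK.
rewrite !E// mulrA ler_pdivlMr ?powR_gt0// mulrAC ler_pdivrMr ?powR_gt0//.
by rewrite mulrC -mulrA.
Qed.

Lemma powR_doubling a (x y : R) : 0 < x -> x <= y -> y <= 2 * x ->
  x `^ a <= 2 `^ `|a| * y `^ a /\ y `^ a <= 2 `^ `|a| * x `^ a.
Proof.
move=> x0 xy y2; have y0 : 0 < y by apply: lt_le_trans xy.
have t1 : 1 <= 2 `^ `|a| :> R by rewrite -[leLHS](powRr0 2) ler_powR// ler1n.
have H c : 0 <= c ->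
    x `^ c <= y `^ c /\ y `^ c <= 2 `^ c * x `^ c.
  move=> c0; split; first by rewrite ge0_ler_powR// nnegrE ltW.
  by rewrite -powRM ?(ltW x0)// ge0_ler_powR// nnegrE ?mulr_ge0
    ?(ltW x0) ?(ltW y0).
have K z c : 0 < z -> z `^ c <= 2 `^ `|a| * z `^ c.
  by move=> z0; rewrite ler_peMl// powR_ge0.
have [a0|a0] := leP 0 a.
  rewrite ger0_norm// in K *; have [h1 h2] := H a a0; split => //.
  exact: le_trans h1 (K _ _ y0).
rewrite ltr0_norm// in t1 K *.
have [h1 h2] := H (- a) ltac:(lra).
rewrite -(opprK a) !(powRN _ (- a)) opprK.
have px : 0 < x `^ - a by exact: powR_gt0.
have py : 0 < y `^ - a by exact: powR_gt0.
have := K x a x0; rewrite -{1 3}(opprK a) !(powRN _ (- a)) => kx.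
split; last first.
  by apply: le_trans kx; rewrite lef_pV2// posrE.
by rewrite ler_pdivlMr// mulrC ler_pdivrMr.
Qed.

Lemma plog_doubling a b : exists2 C, 0 < C & forall h n,
  (0 < h <= n)%N -> (n <= h.*2)%N ->
  plog a b h <= C * plog a b n /\ plog a b n <= C * plog a b h.
Proof.
exists (2 `^ `|a| * 2 `^ `|b|); first by rewrite mulr_gt0// powR_gt0.
move=> h n /andP[h0 hn] n2.
have [|||a1 a2] := @powR_doubling a h%:R n%:R.
- by rewrite ltr0n.
- by rewrite ler_nat.
- by rewrite -natrM ler_nat mul2n.
have [|||b1 b2] := @powR_doubling b (ln h.+1%:R) (ln n.+1%:R).
- exact: lnS_gt0.
- exact: lnS_le.
- rewrite -[2]/(2%:R) -ln_powR powR_mulrn ?ler0n//.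
  (* ln (n+1) <= 2 ln (h+1), as n + 1 <= 2h + 1 <= (h+1)^2. *)
  rewrite ler_ln ?posrE ?exprn_gt0 ?ltr0n// -natrX ler_nat; nia.
by rewrite /plog; split; rewrite mulrACA ler_pM// powR_ge0.
Qed.

(** The integral comparison for $\sum j^{-1-a}$ in telescoping form. With
    $m = n+1$, it says $1 + a/m \le (1 - 1/m)^{-a}$, which follows from
    $\log(1-t) \le -t$ and $1 + u \le e^u$. *)
Lemma powR_neg_telescope a n : 0 < a -> (0 < n)%N ->
  n.+1%:R `^ (- (1 + a)) <= a^-1 * (n%:R `^ (- a) - n.+1%:R `^ (- a)).
Proof.
move=> a0 n0; have nR : 0 < n%:R :> R by rewrite ltr0n.
have mR : 0 < n.+1%:R :> R by rewrite ltr0n.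
rewrite mulrC ler_pdivlMr// opprD powRDp// (powRN _ 1) powRr1 ?(ltW mR)//.
have -> : n%:R `^ (- a) = n.+1%:R `^ (- a) * (n%:R / n.+1%:R) `^ (- a).
  by rewrite -powRM ?divr_ge0 ?ler0n// mulrC divfK// gt_eqF.
rewrite mulrAC mulrC -{3}[_.+1%:R `^ _]mulr1 -mulrBr ler_wpM2l ?powR_ge0//.
rewrite /powR gt_eqF ?divr_gt0//.
have := expR_ge1Dx (- a * ln (n%:R / n.+1%:R)).
have := @le_ln1Dx R (- n.+1%:R^-1).
have -> : 1 + - n.+1%:R^-1 = n%:R / n.+1%:R :> R.
  rewrite -natr1 -[X in X - _ = _](@divff _ (n%:R + 1)) ?natr1 ?gt_eqF//.
  by rewrite -mulN1r -mulrDl -natr1 addrK.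
rewrite ltrN2 invf_lt1// ltr1n ltnS => /(_ n0) h.
have : a * ln (n%:R / n.+1%:R) <= a * - n.+1%:R^-1 by rewrite ler_pM2l.
by set l := ln _; set v := _^-1; rewrite mulrN mulNr [v * a]mulrC => ? ?; lra.
Qed.

Lemma sum_powR_tail a n N : 0 < a -> (0 < n)%N ->
  \sum_(n <= j < N) j.+1%:R `^ (- (1 + a)) <= a^-1 * n%:R `^ (- a).
Proof.
move=> a0 n0; have [nN|Nn] := leqP n N; last first.
  by rewrite big_geq ?(ltnW Nn)// mulr_ge0 ?powR_ge0// invr_ge0 ltW.
apply: (@le_trans _ _
   (\sum_(n <= j < N) a^-1 * (j%:R `^ (- a) - j.+1%:R `^ (- a)))).
  rewrite !big_nat; apply: ler_sum => j /andP[nj _].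
  by rewrite powR_neg_telescope// (leq_trans n0).
rewrite -mulr_sumr (telescope_sumr_eq (fun j => - j%:R `^ (- a)))//.
  rewrite ler_pM2l ?invr_gt0// opprK; have := powR_ge0 N%:R (- a); lra.
by move=> j _; rewrite opprK addrC.
Qed.

(** The running maximum of an almost increasing sequence is comparable with its
    last term. *)
Lemma weight_equiv a b : 0 < a -> exists2 C, 0 < C & forall j,
  plog a b j.+1 <= weight a b j <= C * plog a b j.+1.
Proof.
move=> a0; have [C C0 HC] := plog_almost_incr b a0.
exists C => // j; rewrite /weight; apply/andP; split.
  apply: (@bigmax_sup_seq _ _ _ _ _ j.+1) => //.
  by rewrite mem_index_iota /= ltnSn.
rewrite big_nat; apply: (big_ind (fun x => x <= C * plog a b j.+1)).
- by rewrite mulr_ge0 ?ltW// plog_gt0.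
- by move=> x y hx hy; rewrite ge_max hx.
- by move=> i /andP[i0 ij]; apply: HC; rewrite i0.
Qed.

End PowerLog.

(** * Norms controlled by partial sums *)

Section lp_norm_partial_sums.
Variable R : realType.
Implicit Types (q B : R) (y : R^nat).

Lemma lp_norm_le q B y : 0 < q -> 0 <= B ->
  (forall N, \sum_(0 <= j < N) `|y j| `^ q <= B `^ q) ->
  (lp_norm q%:E y <= B%:E)%E.
Proof.
move=> q0 B0 H; rewrite lp_norm_fin//.
have -> : B%:E = ((B `^ q)%:E `^ q^-1)%E.
  by rewrite poweR_EFin -powRrM mulfV ?gt_eqF// powRr1.
have S0 : (0 <= \sum_(0 <= j <oo) (`|y j| `^ q)%:E)%E.
  by apply: nneseries_ge0 => j _ _; rewrite lee_fin powR_ge0.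
apply: gt0_ler_poweR; rewrite ?invr_ge0 ?(ltW q0)// ?in_itv/= ?leey ?andbT//.
  by rewrite lee_fin powR_ge0.
apply: lime_le.
  by apply: is_cvg_nneseries => j _ _; rewrite lee_fin powR_ge0.
by apply: nearW => N; rewrite sumEFin lee_fin.
Qed.

Lemma partial_sum_le_lp_norm q y N : 0 < q ->
  ((\sum_(0 <= j < N) `|y j| `^ q)%:E `^ q^-1 <= lp_norm q%:E y)%E.
Proof.
move=> q0; rewrite lp_norm_fin//.
have S0 : (0 <= \sum_(0 <= j <oo) (`|y j| `^ q)%:E)%E.
  by apply: nneseries_ge0 => j _ _; rewrite lee_fin powR_ge0.
apply: gt0_ler_poweR; rewrite ?invr_ge0 ?(ltW q0)// ?in_itv/= ?leey ?andbT//.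
  by rewrite lee_fin sumr_ge0// => j _; rewrite powR_ge0.
by rewrite -sumEFin; apply: nneseries_lim_ge => j _ _; rewrite lee_fin powR_ge0.
Qed.

Lemma lp_norm_le1_partial_sum q y N : 0 < q -> (lp_norm q%:E y <= 1)%E ->
  \sum_(0 <= j < N) `|y j| `^ q <= 1.
Proof.
move=> q0 /(le_trans (partial_sum_le_lp_norm y N q0)).
rewrite poweR_EFin lee_fin => H; rewrite leNgt; apply/negP => S1.
move: H; rewrite leNgt => /negP; apply.
have : 1 `^ q^-1 < (\sum_(0 <= j < N) `|y j| `^ q) `^ q^-1.
  by rewrite gt0_ltr_powR ?invr_gt0 ?nnegrE// (le_trans ler01) ?ltW.
by rewrite powR1.
Qed.

Lemma l2_norm_le B y : 0 <= B ->
  (forall N, \sum_(0 <= j < N) y j ^+ 2 <= B ^+ 2) -> (l2_norm y <= B%:E)%E.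
Proof.
move=> B0 H; apply: lp_norm_le => // N.
rewrite powR_mulrn//; apply: le_trans (H N); apply: ler_sum => j _.
by rewrite powR_mulrn// real_normK// num_real.
Qed.

Lemma l2_norm_ge B y N : 0 <= B ->
  B ^+ 2 <= \sum_(0 <= j < N) y j ^+ 2 -> (B%:E <= l2_norm y)%E.
Proof.
move=> B0 H; apply: le_trans (partial_sum_le_lp_norm y N _) => //.
have -> : B = (B `^ 2) `^ 2^-1 by rewrite -powRrM mulfV// powRr1.
rewrite poweR_EFin lee_fin.
rewrite ge0_ler_powR ?nnegrE ?invr_ge0 ?powR_ge0//.
  by rewrite sumr_ge0// => j _; rewrite powR_ge0.
rewrite powR_mulrn//; apply: le_trans H _; apply: ler_sum => j _.
by rewrite powR_mulrn// real_normK// num_real.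
Qed.

End lp_norm_partial_sums.

(** * Best approximation by n terms *)

Section nterm.
Variable R : realType.
Implicit Types (x S : R^nat) (L : {fset nat}).

Lemma fset_le_bigmax L j : j \in L -> (j <= \max_(i <- L) i)%N.
Proof. by move=> jL; apply: (@leq_bigmax_seq _ (enum_fset L) predT id). Qed.

Lemma fset_pad L n : (#|` L| <= n)%N ->
  exists2 L' : {fset nat}, (L `<=` L')%fset & #|` L'| = n.
Proof.
move=> /subnK <-; elim: (n - _)%N => [|k [L' LL' cL']]; first by exists L.
have fresh : (\max_(j <- L') j).+1 \notin L'.
  by apply/negP => /fset_le_bigmax; rewrite ltnn.
exists ((\max_(j <- L') j).+1 |` L')%fset.
  exact: fsubset_trans LL' (fsubsetU1 _ _).
by rewrite cardfsU1 fresh cL' addSn.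
Qed.

Lemma sum_basis_vec L (c : R^nat) k :
  (\sum_(j <- L) c j *: basis_vec R j) k = if k \in L then c k else 0.
Proof.
have scaleE j : (c j *: basis_vec R j) k = c j * (k == j)%:R by [].
rewrite fct_sumE; case: ifPn => kL.
  rewrite (bigD1_seq k) ?fset_uniq//= big1 ?addr0 => [|j jk].
    by rewrite scaleE eqxx mulr1.
  by rewrite scaleE eq_sym (negbTE jk) mulr0.
rewrite big_seq big1// => j jL; rewrite scaleE.
by case: eqP => [kj|_]; [rewrite kj jL in kL|rewrite mulr0].
Qed.

(** Approximants use exactly $n$ indices, so a smaller index set has to be
    padded, which cannot increase the error. *)
Lemma sigma_le n x L (B : R) : (#|` L| <= n)%N -> 0 <= B ->
  (forall N, \sum_(0 <= j < N | j \notin L) x j ^+ 2 <= B ^+ 2) ->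
  (sigma n x <= B%:E)%E.
Proof.
move=> cL B0 H; have [L' LL' cL'] := fset_pad cL.
pose S : R^nat := \sum_(j <- L') x j *: basis_vec R j.
apply: (@le_trans _ _ (l2_norm (x - S))).
  by apply: ereal_inf_lbound; exists S => //; exists L', x.
apply: l2_norm_le => // N; apply: le_trans (H N).
rewrite [leRHS]big_mkcond/=; apply: ler_sum => j _.
have -> : (x - S) j = x j - S j by [].
rewrite /S sum_basis_vec; case: ifPn => jL'.
  by rewrite subrr expr0n/=; case: ifP => // _; exact: sqr_ge0.
by rewrite subr0 (contra (fsubsetP LL' j) jL').
Qed.

Lemma sigma_ge n x N (B : R) : 0 <= B ->
  (forall L, #|` L| = n ->
    B ^+ 2 <= \sum_(0 <= j < N | j \notin L) x j ^+ 2) ->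
  (B%:E <= sigma n x)%E.
Proof.
move=> B0 H; apply: le_ereal_inf_tmp => _ [_ [L [c [cL ->]]] <-].
apply: (@l2_norm_ge _ _ _ N) => //; apply: le_trans (H L cL) _.
rewrite big_mkcond/=; apply: ler_sum => j _.
set S : R^nat := \sum_(_ <- _) _.
have -> : (x - S) j = x j - S j by [].
rewrite /S sum_basis_vec; case: ifPn => jL; first by rewrite (negbTE jL) subr0.
exact: sqr_ge0.
Qed.

Lemma fset_sum_le (u : R^nat) (B : R) L : (forall j, 0 <= u j) ->
  (forall N, \sum_(0 <= j < N) u j <= B) -> \sum_(j <- L) u j <= B.
Proof.
move=> u0 H; apply: le_trans (H (\max_(j <- L) j).+1).
have LE : perm_eq L
    [seq j <- index_iota 0 (\max_(j <- L) j).+1 | j \in L].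
  apply: uniq_perm; rewrite ?filter_uniq ?iota_uniq ?fset_uniq//.
  move=> j; rewrite mem_filter mem_index_iota /= ltnS.
  by case: (boolP (j \in L)) => //= /fset_le_bigmax/= ->.
rewrite (perm_big _ LE) big_filter big_mkcond/=.
by apply: ler_sum => j _; case: ifP.
Qed.

(** Chebyshev's inequality: $h$ entries exceeding $h^{-1/q}$ would have a
    $q$-th power sum strictly greater than 1. *)
Lemma few_large_terms (q : R) (a : R^nat) h : 0 < q -> (0 < h)%N ->
  (forall N, \sum_(0 <= j < N) `|a j| `^ q <= 1) ->
  exists2 L : {fset nat}, (#|` L| < h)%N &
    forall j, j \notin L -> `|a j| <= h%:R `^ (- q^-1).
Proof.
move=> q0 h0 H; pose A := [set j | h%:R `^ (- q^-1) < `|a j| ].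
have hR : 0 < h%:R :> R by rewrite ltr0n.
have small (B : {fset nat}) : [set` B] `<=` A -> (#|` B| < h)%N.
  move=> BA; rewrite ltnNge; apply/negP => hB.
  have Bn : (0 < #|` B|)%N by apply: leq_trans hB.
  have := fset_sum_le B (fun j => powR_ge0 _ _) H.
  rewrite leNgt => /negP; apply.
  apply: (@le_lt_trans _ _ (\sum_(j <- B) h%:R^-1)).
    rewrite big_const_seq count_predT iter_addr_0 -[leRHS]mulr_natl.
    by rewrite ler_pdivlMr// mul1r ler_nat.
  have lt j : j \in B -> h%:R^-1 < `|a j| `^ q.
    move=> jB; have /= := BA j jB.
    have -> : h%:R^-1 = (h%:R `^ (- q^-1)) `^ q.
      by rewrite -powRrM mulNr mulVf ?gt_eqF// powR_inv1// ltW.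
    by move=> hj; rewrite gt0_ltr_powR ?nnegrE ?powR_ge0.
  move: Bn; rewrite cardfs_gt0 => /fset0Pn[k kB].
  rewrite (bigD1_seq k) ?fset_uniq//= [ltRHS](bigD1_seq k) ?fset_uniq//=.
  rewrite ltr_leD ?lt//.
  rewrite big_seq_cond [leRHS]big_seq_cond; apply: ler_sum => j /andP[jB _].
  by rewrite ltW ?lt.
have fA : finite_set A.
  apply: contrapT => /(infinite_set_fset h)[B BA hB].
  by have := small B BA; rewrite ltnNge hB.
exists (fset_set A) => [|j]; first by apply: small; rewrite fset_setK.
by rewrite in_fset_set// notin_setE /= => /negP; rewrite -leNgt.
Qed.

Lemma lpw_ball_partial_sum (q : R) (w x : R^nat) N : 0 < q ->
  lpw_ball q%:E w x -> \sum_(0 <= j < N) `|w j * x j| `^ q <= 1.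
Proof. by move=> q0 [_]; exact: lp_norm_le1_partial_sum. Qed.

Lemma lpw_ball_sup (w x : R^nat) j :
  lpw_ball +oo%E w x -> `|w j * x j| <= 1.
Proof.
move=> [_]; rewrite /lpw_norm lp_norm_infty => H; rewrite -lee_fin.
by apply: le_trans H; apply: ereal_sup_ubound; exists j.
Qed.

End nterm.

(** * Upper bounds *)

Section bounds.
Variable R : realType.
Implicit Types (x : R^nat) (alpha beta q r : R).

Lemma sqr_le_powR_small q (t a : R) : q <= 2 -> 0 <= a -> a <= t ->
  a ^+ 2 <= t `^ (2 - q) * a `^ q.
Proof.
move=> q2 a0 ta; move: a0; rewrite le_eqVlt => /predU1P[<-|a0].
  by rewrite expr0n/= mulr_ge0 ?powR_ge0.
rewrite -powR_mulrn ?(ltW a0)// -{1}(subrK q 2%:R) powRDp//.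
rewrite ler_wpM2r ?powR_ge0// ge0_ler_powR ?nnegrE ?subr_ge0 ?(ltW a0)//.
exact: le_trans (ltW a0) ta.
Qed.

(** The pointwise substitute for Hölder's inequality. Above the threshold $t$
    the first term alone dominates, below it the second. *)
Lemma sqr_le_powR_large q (t a : R) : 2 <= q -> 0 < t -> 0 <= a ->
  a ^+ 2 <= a `^ q * t `^ (2 - q) + t ^+ 2.
Proof.
move=> q2 t0 a0; have [at_|ta] := leP a t.
  rewrite (@le_trans _ _ (t ^+ 2)) ?lerXn2r ?nnegrE ?(ltW t0)//.
  by rewrite lerDr mulr_ge0 ?powR_ge0.
have {}a0 : 0 < a by apply: lt_trans ta.
rewrite (@le_trans _ _ (a `^ q * t `^ (2 - q)))//; last first.
  by rewrite lerDl exprn_ge0// ltW.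
rewrite -[2 - q]opprB powRN ler_pdivlMr ?powR_gt0//.
have -> : a `^ q = a `^ (q - 2) * a ^+ 2.
  by rewrite -powR_mulrn ?(ltW a0)// -powRDp// subrK.
rewrite mulrC ler_wpM2r ?exprn_ge0 ?(ltW a0)//.
by rewrite ge0_ler_powR ?nnegrE ?subr_ge0 ?(ltW a0) ?(ltW t0) ?(ltW ta).
Qed.

Lemma sqrM_le_scaled (k C w x : R) : 0 <= k -> k <= C * w ->
  k ^+ 2 * x ^+ 2 <= C ^+ 2 * `|w * x| ^+ 2.
Proof.
move=> k0 kC.
have -> : C ^+ 2 * `|w * x| ^+ 2 = (C * w) ^+ 2 * x ^+ 2.
  by rewrite real_normK ?num_real// !exprMn mulrA.
by rewrite ler_wpM2r ?sqr_ge0// lerXn2r ?nnegrE// (le_trans k0).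
Qed.

Definition initial n : {fset nat} := seq_fset tt (iota 0 n).

Lemma in_initial n j : (j \in initial n) = (j < n)%N.
Proof. by rewrite seq_fsetE mem_iota. Qed.

Lemma card_initial n : #|` initial n| = n.
Proof. by rewrite size_seq_fset undup_id ?iota_uniq// size_iota. Qed.

(** For $q \le 2$ the large entries may sit anywhere, so the approximant must
    depend on $x$. About half of the $n$ terms are spent on the head and the
    others on the entries found by [few_large_terms]. *)
Lemma sigma_le_sparse alpha beta q : 0 < alpha -> 0 < q -> q <= 2 ->
  exists2 C, 0 < C & forall n x, (0 < n)%N ->
    lpw_ball q%:E (weight alpha beta) x ->
    (sigma n x <= (C * plog (- (alpha + q^-1 - 2^-1)) (- beta) n)%:E)%E.
Proof.
move=> alpha0 q0 q2; set s := _ - 2^-1.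
have [C1 C10 H1] := plog_almost_incr beta alpha0.
have [C2 C20 H2] := plog_doubling (- s) (- beta).
have [C3 C30 H3] := weight_equiv beta alpha0.
exists (C1 * C2); first exact: mulr_gt0.
move=> n x n0 bx; pose w := weight alpha beta.
(* Rounding up keeps h positive for n = 1, and h + (h - 1) <= n still holds. *)
pose h := uphalf n.
have h0 : (0 < h)%N by rewrite uphalf_gt0.
have hn : (h <= n)%N by rewrite /h uphalfE; lia.
have nh : (n <= h.*2)%N by rewrite /h; lia.
have S1 N := lpw_ball_partial_sum N q0 bx.
have [L cL HL] := few_large_terms q0 h0 S1.
apply: (@sigma_le _ _ _ (initial h `|` L)%fset).
- rewrite (leq_trans (leq_card_fsetU _ _))// card_initial.
  by move: cL; rewrite /h; lia.
- by rewrite !mulr_ge0 ?powR_ge0 ?ltW.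
move=> N; pose D := C1 * plog (- s) (- beta) h.
have D0 : 0 < D by rewrite mulr_gt0// plog_gt0.
apply: (@le_trans _ _ (D ^+ 2)); last first.
  have [|le2 _] := H2 h n _ nh; first by rewrite h0.
  have Dle : D <= C1 * C2 * plog (- s) (- beta) n by rewrite /D -mulrA ler_pM2l.
  by rewrite lerXn2r ?nnegrE ?(ltW D0)// (le_trans (ltW D0)).
rewrite -[leRHS]mulr1.
apply: (@le_trans _ _ (D ^+ 2 * \sum_(0 <= j < N) `|w j * x j| `^ q));
  last by rewrite ler_wpM2l ?sqr_ge0.
rewrite mulr_sumr big_mkcond/=; apply: ler_sum => j _.
case: ifPn => [|_]; last by rewrite mulr_ge0 ?sqr_ge0 ?powR_ge0.
rewrite in_fsetU in_initial negb_or -leqNgt => /andP[hj /HL aj].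
have ph : 0 < plog alpha beta h by apply: plog_gt0.
have wj : plog alpha beta h <= C1 * w j.
  apply: le_trans (H1 h j.+1 _) _; first by rewrite h0 (leq_trans hj).
  by rewrite ler_pM2l//; have /andP[] := H3 j.
have xa := sqrM_le_scaled (x j) (ltW ph) wj.
have aq := sqr_le_powR_small q2 (normr_ge0 _) aj.
have DE : D ^+ 2 =
    C1 ^+ 2 * (h%:R `^ - q^-1) `^ (2 - q) / plog alpha beta h ^+ 2.
  have hR : 0 < h%:R :> R by rewrite ltr0n.
  rewrite /D exprMn -[RHS]mulrA; congr (_ * _).
  have -> : - s = (1 - 2 / q) / 2 - alpha by rewrite /s; lra.
  rewrite plogB// expr_div_n powR_half_sqr -powRrM; congr (_ `^ _ / _).
  by field; rewrite gt_eqF.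
rewrite DE mulrAC ler_pdivlMr ?exprn_gt0// mulrC.
by apply: le_trans xa _; rewrite -[leRHS]mulrA ler_wpM2l ?sqr_ge0.
Qed.

(** The hypothesis on [x] is what [sqr_le_powR_large] yields at the threshold
    $j^{-r}$ with $u_j = |w_jx_j|^p$, and it also covers $p = \infty$, with
    $r = 0$ and $u = 0$. Splitting $\varphi(j) = j^{\alpha - s/2} \cdot
    j^{s/2}\log(j+1)^\beta$, whose second factor is almost increasing, shows that
    $w_j$ grows at least like $j^{\alpha - s/2}$ beyond $n$; this exponent leaves
    room $s$ in the convergence of the tail sum. *)
Lemma sigma_le_tail alpha beta r : 0 < alpha -> 0 < alpha + r - 2^-1 ->
  exists2 C, 0 < C & forall n x (u : R^nat), (0 < n)%N ->
    (forall j, 0 <= u j) -> (forall N, \sum_(0 <= j < N) u j <= 1) ->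
    (forall j, `|weight alpha beta j * x j| ^+ 2 <=
       u j * j.+1%:R `^ (1 - 2 * r) + j.+1%:R `^ (- (2 * r))) ->
    (sigma n x <= (C * plog (- (alpha + r - 2^-1)) (- beta) n)%:E)%E.
Proof.
move=> alpha0; set s := _ - 2^-1 => s0.
have [C1 C10 H1] := plog_almost_incr beta (divr_gt0 s0 (ltr0n _ 2)).
have [C3 C30 H3] := weight_equiv beta alpha0.
have c0 : 0 < 1 + s^-1 by rewrite addr_gt0// invr_gt0.
(* The estimate of the squared error carries the factor 1 + 1/s, which is at
   most its own square. *)
exists (C1 * (1 + s^-1)); first exact: mulr_gt0.
move=> n x u n0 u0 Su Hx.
apply: (@sigma_le _ _ _ (initial n)); first by rewrite card_initial.
  by rewrite !mulr_ge0 ?powR_ge0 ?ltW.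
move=> N; pose w := weight alpha beta; pose P := plog (s / 2) beta n.
have P0 : 0 < P by apply: plog_gt0.
pose E := C1 ^+ 2 / P ^+ 2.
have E0 : 0 <= E by rewrite divr_ge0 ?sqr_ge0.
have nR : 0 < n%:R :> R by rewrite ltr0n.
have key j : (n <= j)%N -> x j ^+ 2 <=
    E * (u j * n%:R `^ (- s) + j.+1%:R `^ (- (1 + s))).
  move=> nj; have jR : 0 < j.+1%:R :> R by rewrite ltr0n.
  pose g : R := j.+1%:R `^ (alpha - s / 2).
  have g0 : 0 < g by apply: powR_gt0.
  have wj : g * P <= C1 * w j.
    have /andP[wj _] := H3 j.
    rewrite (@le_trans _ _ (C1 * plog alpha beta j.+1)) ?ler_pM2l//.
    rewrite -[alpha](subrK (s / 2)) -[beta in leRHS]add0r plogD// plog0 -/g.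
    by rewrite [leRHS]mulrCA ler_pM2l// H1// n0 (leq_trans nj).
  have xa := sqrM_le_scaled (x j) (mulr_ge0 (ltW g0) (ltW P0)) wj.
  have {}xa : x j ^+ 2 <= E * ((u j * j.+1%:R `^ (1 - 2 * r) +
                               j.+1%:R `^ (- (2 * r))) / g ^+ 2).
    rewrite /E mulrACA -invfM -exprMn [P * g]mulrC.
    rewrite ler_pdivlMr ?exprn_gt0 ?(mulr_gt0 g0 P0)//.
    by rewrite [leLHS]mulrC (le_trans xa)// ler_wpM2l ?sqr_ge0.
  apply: le_trans xa _; rewrite ler_wpM2l// mulrDl -mulrA.
  have gE b : j.+1%:R `^ b / g ^+ 2 = j.+1%:R `^ (b - (2 * alpha - s)).
    rewrite powRDp// powRN; congr (_ / _).
    rewrite /g -powR_mulrn ?powR_ge0// -powRrM; congr (_ `^ _).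
    by field.
  rewrite !gE.
  have -> : 1 - 2 * r - (2 * alpha - s) = - s by rewrite /s; field.
  have -> : - (2 * r) - (2 * alpha - s) = - (1 + s) by rewrite /s; field.
  rewrite lerD2r ler_wpM2l// !powRN lef_pV2 ?posrE ?powR_gt0//.
  by rewrite ge0_ler_powR ?nnegrE ?(ltW s0) ?ler0n// ler_nat (leq_trans nj).
apply: (@le_trans _ _ (E * (n%:R `^ (- s) + s^-1 * n%:R `^ (- s)))); last first.
  have EE : E * n%:R `^ (- s) = (C1 * plog (- s) (- beta) n) ^+ 2.
    rewrite /E [RHS]exprMn -[LHS]mulrA; congr (_ * _).
    have -> : - s = - s / 2 - s / 2 by lra.
    rewrite (plogB (s / 2) beta (- s / 2) n0) expr_div_n powR_half_sqr mulrC.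
    by congr (_ `^ _ / _); lra.
  rewrite -[X in X + _]mul1r -mulrDl mulrCA EE mulrAC [leRHS]exprMn mulrC.
  rewrite ler_wpM2l ?sqr_ge0// expr2 ler_peMl ?(ltW c0)//.
  by rewrite lerDl invr_ge0 ltW.
rewrite big_mkcond/=.
rewrite (eq_bigr (fun j => if (n <= j)%N then x j ^+ 2 else 0)); last first.
  by move=> j _; rewrite in_initial -leqNgt.
apply: (@le_trans _ _ (\sum_(0 <= j < N) (E * n%:R `^ (- s) * u j +
    E * (if (n <= j)%N then j.+1%:R `^ (- (1 + s)) else 0)))).
  apply: ler_sum => j _; case: ifPn => [nj|_].
    by rewrite (le_trans (key j nj))// mulrDr mulrA mulrAC.
  by rewrite mulr0 addr0 mulr_ge0 ?u0// mulr_ge0 ?powR_ge0.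
rewrite big_split/= -!mulr_sumr mulrDr lerD//.
  by rewrite -[leRHS]mulr1 ler_wpM2l// mulr_ge0 ?powR_ge0.
rewrite ler_wpM2l// (le_trans _ (sum_powR_tail N s0 n0))//.
rewrite -big_mkcond/= le_eqVlt; apply/orP; left; apply/eqP.
have [nN|Nn] := leqP n N.
  rewrite (big_cat_nat (leq0n n) nN)/= big_nat_cond big1 ?add0r => [|j].
    rewrite big_nat_cond [RHS]big_nat; apply: eq_bigl => j.
    by case: (n <= j)%N; rewrite ?andbT.
  by rewrite leq0n/= ltnNge => /andP[/negbTE->].
rewrite [RHS]big_geq ?(ltnW Nn)// big_nat_cond big1// => j.
by case/andP => /andP[_ jN]; rewrite leqNgt (ltn_trans jN Nn).
Qed.

(** * Lower bound by flat vectors *)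

Definition flat (m : nat) (v : R) : R^nat := fun j => if (j < m)%N then v else 0.

(** The factor 2 in the support of the flat vector guarantees that at least half
    of its entries survive the removal of any $n$ terms. *)
Lemma sigma_ge_flat alpha beta r : 0 < alpha ->
  exists2 C, 0 < C & forall n, (0 < n)%N -> exists v : R, [/\ 0 <= v,
    (forall j, (j < n.*2)%N -> weight alpha beta j * v <= n.*2%:R `^ (- r)) &
    ((C * plog (- (alpha + r - 2^-1)) (- beta) n)%:E <=
       sigma n (flat n.*2 v))%E].
Proof.
move=> alpha0; set s := _ - 2^-1.
have [C1 C10 H1] := plog_almost_incr beta alpha0.
have [C2 C20 H2] := plog_doubling (- s) (- beta).
have [C3 C30 H3] := weight_equiv beta alpha0.
exists (C2 * (C3 * C1) * 2)^-1; first by rewrite invr_gt0 !mulr_gt0.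
move=> n n0; set m := n.*2; have m0 : (0 < m)%N by rewrite double_gt0.
have mR : 0 < m%:R :> R by rewrite ltr0n.
have pm : 0 < plog alpha beta m by apply: plog_gt0.
pose v := m%:R `^ (- r) / (C3 * C1 * plog alpha beta m).
have K0 : 0 < C3 * C1 by rewrite mulr_gt0.
have Kpm := mulr_gt0 K0 pm.
have v0 : 0 <= v by rewrite divr_ge0 ?powR_ge0 ?(ltW Kpm).
exists v; split => // [j jm|].
  rewrite /v mulrA ler_pdivrMr// mulrC ler_wpM2l ?powR_ge0//.
  have /andP[_ wj] := H3 j; apply: le_trans wj _.
  by rewrite -mulrA ler_pM2l// H1.
(* B^2 is half of n v^2, the energy of the n entries that survive. *)
pose B := plog (- s) (- beta) m / (C3 * C1 * 2).
have BE : B ^+ 2 = m%:R * v ^+ 2 / 4.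
  rewrite /B.
  have -> : - s = 1 / 2 - r - alpha by rewrite /s; lra.
  have -> : m%:R * v ^+ 2 / 4 = (m%:R `^ (1 / 2)) ^+ 2 * v ^+ 2 / 4.
    by rewrite powR_half_sqr powRr1 ?(ltW mR).
  rewrite plogB// powRDp// /v.
  by field; rewrite !gt_eqF.
have BC : (C2 * (C3 * C1) * 2)^-1 * plog (- s) (- beta) n <= B.
  have [||le2 _] := H2 n m; first by rewrite n0 /m -addnn leq_addr.
    by [].
  rewrite /B ler_pdivlMr ?mulr_gt0// mulrAC.
  have -> : (C2 * (C3 * C1) * 2)^-1 * (C3 * C1 * 2) = C2^-1.
    by field; rewrite !gt_eqF.
  by rewrite mulrC ler_pdivrMr// mulrC.
have K20 : 0 < C3 * C1 * 2 by rewrite mulr_gt0.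
have B0 : 0 <= B by exact: divr_ge0 (ltW (plog_gt0 _ _ m0)) (ltW K20).
apply: (@le_trans _ _ B%:E); first by rewrite lee_fin.
apply: (@sigma_ge _ _ _ m) => // L cL.
rewrite BE.
have -> : \sum_(0 <= j < m | j \notin L) flat m v j ^+ 2
   = (\sum_(0 <= j < m | j \notin L) 1)%:R * v ^+ 2.
  rewrite natr_sum mulr_suml big_nat_cond [RHS]big_nat_cond.
  by apply: eq_bigr => j /andP[/andP[_ jm] _]; rewrite /flat jm mul1r.
have cnt : (n <= \sum_(0 <= j < m | j \notin L) 1)%N.
  have : (\sum_(0 <= j < m | j \in L) 1 <= n)%N.
    rewrite -cL -big_filter sum1_size uniq_leq_size ?filter_uniq ?iota_uniq//.
    by move=> j; rewrite mem_filter => /andP[].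
  have : (\sum_(0 <= j < m) 1 = m)%N by rewrite sum_nat_const_nat subn0 muln1.
  by rewrite (bigID (fun j => j \in L))/= /m -addnn; lia.
rewrite mulrAC ler_wpM2r ?sqr_ge0//.
rewrite ler_pdivrMr// -natrM ler_nat.
by apply: leq_trans (leq_mul cnt (leqnn 4)); rewrite /m -muln2 leq_mul2l orbT.
Qed.

Lemma sum_initial_le (f : nat -> R) (c : R) m N : 0 <= c ->
  (forall j, (j < m)%N -> f j <= c) -> (forall j, (m <= j)%N -> f j <= 0) ->
  \sum_(0 <= j < N) f j <= m%:R * c.
Proof.
move=> c0 fc f0; elim: N f m fc f0 => [|N IH] f m fc f0.
  by rewrite big_geq// mulr_ge0.
rewrite big_nat_recl//; case: m fc f0 => [|m] fc f0.
  rewrite mul0r -[leRHS]addr0 lerD ?f0//.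
  by apply: sumr_le0 => j _; exact: f0.
rewrite -nat1r mulrDl mul1r lerD ?fc//.
by apply: IH => j jm; [apply: fc|apply: f0].
Qed.

Lemma l2_norm_flat m (v : R) : (l2_norm (flat m v) < +oo)%E.
Proof.
apply: (@le_lt_trans _ _ (1 + m%:R * v ^+ 2)%:E); last exact: ltry.
have S0 : 0 <= m%:R * v ^+ 2 by rewrite mulr_ge0 ?sqr_ge0.
apply: l2_norm_le => [|N]; first by rewrite addr_ge0.
apply: (@le_trans _ _ (m%:R * v ^+ 2)); last by nra.
apply: sum_initial_le => [|j jm|j mj]; first exact: sqr_ge0.
  by rewrite /flat jm.
by rewrite /flat ltnNge mj expr0n.
Qed.

Lemma flat_ball_fin (w : R^nat) q (m : nat) (v : R) : 0 < q -> 0 <= v ->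
  (0 < m)%N -> (forall j, 0 <= w j) ->
  (forall j, (j < m)%N -> w j * v <= m%:R `^ (- q^-1)) ->
  lpw_ball q%:E w (flat m v).
Proof.
move=> q0 v0 m0 w0 wv.
have wb : (lpw_norm q%:E w (flat m v) <= 1)%E.
  apply: lp_norm_le => // N; rewrite powR1.
  have mR : 0 < m%:R :> R by rewrite ltr0n.
  have -> : 1 = m%:R * m%:R^-1 :> R by rewrite divff ?gt_eqF.
  apply: sum_initial_le => [|j jm|j mj]; first by rewrite invr_ge0 ltW.
    have wv0 : 0 <= w j * v by rewrite mulr_ge0.
    have -> : m%:R^-1 = (m%:R `^ (- q^-1)) `^ q.
      by rewrite -powRrM mulNr mulVf ?gt_eqF// powR_inv1// ltW.
    rewrite /flat jm ger0_norm// ge0_ler_powR ?nnegrE ?powR_ge0 ?(ltW q0)//.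
    exact: wv.
  by rewrite /flat ltnNge mj mulr0 normr0 powR0// gt_eqF.
split => //; split; first exact: l2_norm_flat.
exact: le_lt_trans wb (ltry _).
Qed.

Lemma flat_ball_infty (w : R^nat) (m : nat) (v : R) : 0 <= v ->
  (forall j, 0 <= w j) -> (forall j, (j < m)%N -> w j * v <= 1) ->
  lpw_ball +oo%E w (flat m v).
Proof.
move=> v0 w0 wv.
have wb : (lpw_norm +oo%E w (flat m v) <= 1)%E.
  rewrite /lpw_norm lp_norm_infty; apply: ge_ereal_sup => _ [j _ <-].
  rewrite lee_fin /flat; case: ifPn => jm; last by rewrite mulr0 normr0.
  by rewrite ger0_norm ?mulr_ge0// wv.
split => //; split; first exact: l2_norm_flat.
exact: le_lt_trans wb (ltry _).
Qed.

End bounds.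

(* p^-1 is taken in the extended reals, where +oo^-1 = 0. *)
Theorem corollary3p2 (R : realType) (p : \bar R) (alpha beta : R)
    (hp : (0 < p)%E) (halpha : 0 < alpha)
    (hs : 0 < alpha + fine (p^-1)%E - 2^-1) :
  exists C1 C2 : R, [/\ 0 < C1, 0 < C2 &
    forall n : nat, (1 <= n)%N ->
      ((C1 * (n%:R `^ (- (alpha + fine (p^-1)%E - 2^-1))
              * ln n.+1%:R `^ (- beta)))%:E
         <= sigma_set n (lpw_ball p (weight alpha beta)))%E /\
      (sigma_set n (lpw_ball p (weight alpha beta))
         <= (C2 * (n%:R `^ (- (alpha + fine (p^-1)%E - 2^-1))
                   * ln n.+1%:R `^ (- beta)))%:E)%E].
Proof.
set r := fine _ in hs *.
have w0 j : 0 <= weight alpha beta j.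
  have [C _ /(_ j)/andP[wj _]] := weight_equiv beta halpha.
  by apply: le_trans wj; rewrite ltW// plog_gt0.
have ball_flat n v : (0 < n)%N -> 0 <= v ->
    (forall j, (j < n)%N -> weight alpha beta j * v <= n%:R `^ (- r)) ->
    lpw_ball p (weight alpha beta) (flat n v).
  move: hp @r {hs}; case: p => [q| |]//; rewrite ?lte_fin => q0 /= n0 v0.
    by rewrite inver gt_eqF//=; exact: flat_ball_fin.
  by rewrite oppr0 powRr0; exact: flat_ball_infty.
have [C2 C20 upper] : exists2 C, 0 < C & forall n x, (0 < n)%N ->
    lpw_ball p (weight alpha beta) x ->
    (sigma n x <= (C * plog (- (alpha + r - 2^-1)) (- beta) n)%:E)%E.
  move: hp @r hs {ball_flat}; case: p => [q| |]//; rewrite ?lte_fin => q0 /=.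
    rewrite inver gt_eqF//= => hs; have [q2|q2] := leP q 2.
      exact: sigma_le_sparse.
    have [C C0 HC] := sigma_le_tail beta halpha hs.
    exists C => // n x n0 bx.
    apply: (HC n x (fun j => `|weight alpha beta j * x j| `^ q)) => //.
      by move=> N; exact: lpw_ball_partial_sum.
    move=> j; have J0 : 0 < j.+1%:R `^ (- q^-1) :> R by rewrite powR_gt0.
    apply: le_trans (sqr_le_powR_large (ltW q2) J0 (normr_ge0 _)) _.
    rewrite -powRrM -(@powR_mulrn _ _ 2 (ltW J0)) -powRrM.
    have -> : - q^-1 * (2 - q) = 1 - 2 * q^-1 by field; rewrite gt_eqF.
    by have -> : - q^-1 * 2 = - (2 * q^-1) by rewrite mulNr mulrC.
  move=> hs.
  have [C C0 HC] := sigma_le_tail beta halpha hs.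
  exists C => // n x n0 bx; apply: (HC n x (fun=> 0)) => //.
    by move=> N; rewrite big1.
  move=> j; rewrite mul0r add0r mulr0 oppr0 powRr0.
  by rewrite expr_le1//; exact: lpw_ball_sup.
have [C1 C10 lower] := sigma_ge_flat beta r halpha.
exists C1, C2; split => // n n0; split.
  have [v [v0 wv sv]] := lower n n0.
  apply: le_trans sv _; apply: ereal_sup_ubound; exists (flat n.*2 v) => //.
  by apply: ball_flat; rewrite ?double_gt0.
by apply: ge_ereal_sup => _ [x bx <-]; exact: upper.
Qed.
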